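(* Let $(\mathbf{u},\mathbf{h})$ be an axially symmetric smooth solution of the steady Hall-MHD equations $$(\mathbf{u}\cdot\nabla)\mathbf{u}+\nabla p=(\mathbf{h}\cdot\nabla)\mathbf{h}+\Delta\mathbf{u},\quad \operatorname{div}\mathbf{u}=0,\quad (\mathbf{u}\cdot\nabla)\mathbf{h}-(\mathbf{h}\cdot\nabla)\mathbf{u}+\nabla\times((\nabla\times\mathbf{h})\times\mathbf{h})=\Delta\mathbf{h},\quad \operatorname{div}\mathbf{h}=0\quad\text{in }\mathbb{R}^3,$$ with $\lim_{|\mathbf{x}|\to\infty}\mathbf{u}(\mathbf{x})=\lim_{|\mathbf{x}|\to\infty}\mathbf{h}(\mathbf{x})=\mathbf{0}$, of the form $\mathbf{u}=u_r(r,z)\mathbf{e}_r+u_\theta(r,z)\mathbf{e}_\theta+u_z(r,z)\mathbf{e}_z$, $\mathbf{h}=h_\theta(r,z)\mathbf{e}_\theta$. Then $\mathbf{h}\equiv 0$.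
   Context: Cylindrical coordinates: $r=\sqrt{x_1^2+x_2^2}$, $\theta=\arctan(x_2/x_1)$, $z=x_3$, with $\mathbf{e}_r=(\cos\theta,\sin\theta,0)$, $\mathbf{e}_\theta=(-\sin\theta,\cos\theta,0)$, $\mathbf{e}_z=(0,0,1)$. A vector field is axially symmetric if its components in this frame do not depend on $\theta$. The scalar function $p$ is the associated pressure. *)

(* Defs.v *)
From mathcomp Require Import all_boot all_order all_algebra.
From mathcomp Require Import all_classical all_reals all_analysis.

Set Implicit Arguments.
Unset Strict Implicit.
Unset Printing Implicit Defensive.

Import Order.TTheory GRing.Theory Num.Theory.
Import numFieldNormedType.Exports.

Local Open Scope classical_set_scope.
Local Open Scope ring_scope.

Definition row3 {R : realType} (a b c : R) : 'rV[R]_3 :=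
  \row_(i < 3) [:: a; b; c]`_i.

(* Coordinates are numbered from 0: x_1, x_2, x_3 are x 0 0, x 0 1, x 0 2. *)
Definition cross {R : realType} (a b : 'rV[R]_3) : 'rV[R]_3 :=
  row3 (a 0 1 * b 0 2 - a 0 2 * b 0 1)
       (a 0 2 * b 0 0 - a 0 0 * b 0 2)
       (a 0 0 * b 0 1 - a 0 1 * b 0 0).

Definition partial {R : realType} {W : normedModType R} (j : 'I_3)
    (f : 'rV[R]_3 -> W) : 'rV[R]_3 -> W :=
  fun x => 'D_(delta_mx 0 j) f x.

Definition iter_partial {R : realType} {W : normedModType R} (s : seq 'I_3)
    (f : 'rV[R]_3 -> W) : 'rV[R]_3 -> W :=
  foldr partial f s.

(* C^oo: f and its partial derivatives of every order are Frechet
   differentiable everywhere. *)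
Definition smooth {R : realType} {W : normedModType R}
    (f : 'rV[R]_3 -> W) : Prop :=
  forall (s : seq 'I_3) (x : 'rV[R]_3), differentiable (iter_partial s f) x.

Definition grad {R : realType} (p : 'rV[R]_3 -> R) (x : 'rV[R]_3) : 'rV[R]_3 :=
  \row_(j < 3) partial j p x.

Definition div {R : realType} (w : 'rV[R]_3 -> 'rV[R]_3) (x : 'rV[R]_3) : R :=
  \sum_(j < 3) partial j w x 0 j.

Definition curl {R : realType} (w : 'rV[R]_3 -> 'rV[R]_3)
    (x : 'rV[R]_3) : 'rV[R]_3 :=
  row3 (partial 1 w x 0 2 - partial 2 w x 0 1)
       (partial 2 w x 0 0 - partial 0 w x 0 2)
       (partial 0 w x 0 1 - partial 1 w x 0 0).

Definition laplacian {R : realType} (w : 'rV[R]_3 -> 'rV[R]_3)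
    (x : 'rV[R]_3) : 'rV[R]_3 :=
  \sum_(j < 3) partial j (partial j w) x.

(* (v . nabla) w *)
Definition advect {R : realType} (v w : 'rV[R]_3 -> 'rV[R]_3)
    (x : 'rV[R]_3) : 'rV[R]_3 :=
  \sum_(j < 3) v x 0 j *: partial j w x.

Definition steady_hall_mhd {R : realType} (u h : 'rV[R]_3 -> 'rV[R]_3)
    (p : 'rV[R]_3 -> R) : Prop :=
  forall x : 'rV[R]_3,
  [/\ advect u u x + grad p x = advect h h x + laplacian u x,
      div u x = 0,
      advect u h x - advect h u x + curl (fun y => cross (curl h y) (h y)) x
        = laplacian h x
    & div h x = 0].

(* The filter |x| -> oo. The library norm on row vectors is the sup norm; being
   equivalent to the Euclidean norm, it yields the same filter. *)
Definition at_infinity {R : realType} : set_system 'rV[R]_3 :=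
  filter_from setT (fun M : R => [set x | M < `|x|]).

Global Instance at_infinity_filter {R : realType} : Filter (@at_infinity R).
Proof.
apply: filter_from_filter; first by exists 0.
move=> M N _ _; exists (Num.max M N) => // x /=.
by rewrite gt_max => /andP[].
Qed.

(* The angle is taken as an independent variable, which avoids the choice of a
   branch of arctan(x_2 / x_1). *)
Definition cyl_point {R : realType} (r theta z : R) : 'rV[R]_3 :=
  row3 (r * cos theta) (r * sin theta) z.

Definition e_r {R : realType} (theta : R) : 'rV[R]_3 :=
  row3 (cos theta) (sin theta) 0.

Definition e_theta {R : realType} (theta : R) : 'rV[R]_3 :=
  row3 (- sin theta) (cos theta) 0.

Definition e_z {R : realType} : 'rV[R]_3 := row3 0 0 1.

(* Main.v *)
(* In cylindrical coordinates, the azimuthal component of the induction equation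
   reads, for [P = h_theta / r],
     P_rr + (3 / r - u_r) P_r + P_zz + (2 P - u_z) P_z = 0   for r > 0:
   the Hall term only contributes [2 P P_z], so that the maximum principle applies
   once [P] is known to tend to [0] at infinity.  Away from the axis, this is
   clear.  Near the axis only [|P| <= e / r] is known a priori, but the drift
   [2 P - u_z] is then at most [3 e / r], and on the cylinder [r <= 1],
   [|z - z0| <= 1] the function [(3 / 2) e / (r + (1 - (z - z0)^2) / 10)] is a
   supersolution larger than [|P|] on the boundary, hence [|P(r, z0)| <= 15 e].
   The axis itself is never reached by the maxima under consideration, thanks to
   an additional barrier [eta / r], where [eta] tends to [0]. *)
Require Import Defs.
From mathcomp Require Import all_boot all_order all_algebra.
From mathcomp Require Import all_classical all_reals all_analysis.
From mathcomp Require Import ring lra.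

Set Implicit Arguments.
Unset Strict Implicit.
Unset Printing Implicit Defensive.

Import Order.TTheory GRing.Theory Num.Theory.
Import numFieldNormedType.Exports.

Local Open Scope classical_set_scope.
Local Open Scope ring_scope.

(** * Functions of one and two real variables *)

Section RealFunctions.
Context {R : realType}.
Implicit Types (f g : R -> R) (x y : R).

Lemma is_derive_add f g x df dg : is_derive x 1 f df -> is_derive x 1 g dg ->
  is_derive x 1 (fun t => f t + g t) (df + dg).
Proof. by move=> Df Dg; exact: is_deriveD. Qed.

Lemma is_derive_sub f g x df dg : is_derive x 1 f df -> is_derive x 1 g dg ->
  is_derive x 1 (fun t => f t - g t) (df - dg).
Proof. by move=> Df Dg; exact: is_deriveB. Qed.

Lemma is_derive_mul f g x df dg : is_derive x 1 f df -> is_derive x 1 g dg ->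
  is_derive x 1 (fun t => f t * g t) (df * g x + f x * dg).
Proof.
move=> Df Dg; apply: (@is_derive_eq _ _ _ (f * g)).
by rewrite /GRing.scale /= addrC mulrC [f x * _]mulrC mulrC [dg * _]mulrC.
Qed.

Lemma is_derive_inv f x df : is_derive x 1 f df -> f x != 0 ->
  is_derive x 1 (fun t => (f t)^-1) (- df / f x ^+ 2).
Proof.
move=> Df fx0; have D := is_deriveV fx0 Df; apply: (is_derive_eq D).
by rewrite /GRing.scale /=; ring.
Qed.

Lemma is_derive_const (l x : R) : is_derive x 1 (fun=> l) (0 : R).
Proof. exact: is_derive_cst. Qed.

Lemma is_derive_sqr f x df : is_derive x 1 f df ->
  is_derive x 1 (fun t => f t ^+ 2) (2 * f x * df).
Proof. by move=> Df; apply: (is_derive_eq (is_derive_mul Df Df)); ring. Qed.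

Lemma is_derive_inv_sqr f x df : is_derive x 1 f df -> f x != 0 ->
  is_derive x 1 (fun t => f t ^- 2) (- 2 * df / f x ^+ 3).
Proof.
move=> Df fx0; have fx20 : f x ^+ 2 != 0 by rewrite expf_neq0.
by apply: (is_derive_eq (is_derive_inv (is_derive_sqr Df) fx20)); field.
Qed.

Lemma is_derive_unique f x d d' :
  is_derive x 1 f d -> is_derive x 1 f d' -> d = d'.
Proof. by move=> [_ <-] [_ <-]. Qed.

Lemma is_derive_continuous f x df : is_derive x 1 f df -> {for x, continuous f}.
Proof.
case=> Df _; apply: (@differentiable_continuous _ R^o R^o).
exact/derivable1_diffP.
Qed.

(** If [g''] were positive, [g'], which vanishes at [x], would be positive just to the right of [x],
    and the mean value theorem would give a value above the maximum. *)
Lemma local_max_derive2 g g' (g'' x d : R) : 0 < d ->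
  (forall y, `|y - x| < d -> is_derive y 1 g (g' y)) ->
  is_derive x 1 g' g'' ->
  (forall y, `|y - x| < d -> g y <= g x) -> g' x = 0 /\ g'' <= 0.
Proof.
move=> d0 Dg Dg' gmax.
have inI y : y \in `]x - d, x + d[ = (`|y - x| < d).
  by rewrite in_itv /= ltr_distl.
have xI : x \in `]x - d, x + d[ by rewrite inI subrr normr0.
have g'x : g' x = 0.
  apply: (@is_derive_unique g x); first by apply: Dg; rewrite subrr normr0.
  apply: (@derive1_at_max _ _ (x - d) (x + d)) => //.
  - by lra.
  - by move=> t; rewrite inI => /Dg[].
  - by move=> t; rewrite inI => /gmax.
split=> //; rewrite leNgt; apply/negP => g''0.
have [Dg'1 Dg'2] := Dg'.
have /cvgrPdist_lt/(_ _ g''0) : (fun t => t^-1 *: ((g' \o shift x) (t *: 1) - g' x))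
    @ 0^' --> g'' by rewrite -Dg'2.
case=> e /= e0 He.
pose m := Num.min e d.
have m0 : 0 < m by rewrite lt_min e0 d0.
have md : m <= d by rewrite ge_min lexx orbT.
have me : m <= e by rewrite ge_min lexx.
have g'pos y : x < y -> y < x + m -> 0 < g' y.
  move=> xy ym; have yx0 : 0 < y - x by rewrite subr_gt0.
  have := He (y - x); rewrite /ball_ /= sub0r normrN gtr0_norm //.
  move=> /(_ _ (lt0r_neq0 yx0)); rewrite /shift /= g'x subr0 /GRing.scale /= mulr1 subrK.
  rewrite ltr_distlC subrr => H.
  have /H/andP[] : y - x < e by lra.
  by rewrite pmulr_rgt0 ?invr_gt0.
have xy : x < x + m / 2 by lra.
have [||c cI] := @MVT _ g g' x (x + m / 2) xy.
- by move=> c; rewrite in_itv /= => /andP[? ?]; apply: Dg; rewrite ltr_distl; lra.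
- apply: derivable_within_continuous => c; rewrite in_itv /= => /andP[? ?].
  by have [] : is_derive c 1 g (g' c) by apply: Dg; rewrite ltr_distl; lra.
move: cI; rewrite in_itv /= => /andP[xc cm].
have gc : 0 < g' c by apply: g'pos => //; lra.
have : g (x + m / 2) <= g x by apply: gmax; rewrite ltr_distl; lra.
move=> H1 H2; have : 0 < g' c * (x + m / 2 - x) by rewrite mulr_gt0 //; lra.
by rewrite -H2; lra.
Qed.

Lemma mean_value (g dg : R -> R) (a b : R) : a < b ->
  (forall x : R, is_derive x 1 g (dg x)) ->
  exists c, [/\ a < c, c < b & g b - g a = dg c * (b - a)].
Proof.
move=> ab Dg; have [|c cI ->] := @MVT _ g dg a b ab.
  by apply: derivable_within_continuous => x _; have [] := Dg x.
by exists c; move: cI; rewrite in_itv /= => /andP[].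
Qed.

(** The double increment of [g] over a square of side [t] equals [t * t] times [gxy] at one point of
    the square, and [t * t] times [gyx] at another, by two mean value arguments in either order.
    Continuity at [(x0, y0)] concludes for small [t]. *)
Lemma mixed_partials (g gx gy gxy gyx : R -> R -> R) (x0 y0 : R) :
  (forall x y : R, is_derive x 1 (g^~ y) (gx x y)) ->
  (forall x y : R, is_derive y 1 (g x) (gy x y)) ->
  (forall x y : R, is_derive y 1 (gx x) (gxy x y)) ->
  (forall x y : R, is_derive x 1 (gy^~ y) (gyx x y)) ->
  {for (x0, y0), continuous (fun p : R * R => gxy p.1 p.2)} ->
  {for (x0, y0), continuous (fun p : R * R => gyx p.1 p.2)} ->
  gxy x0 y0 = gyx x0 y0.
Proof.
move=> Dx Dy Dxy Dyx cxy cyx.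
have step t : 0 < t -> exists c d c' d',
    [/\ x0 < c < x0 + t, y0 < d < y0 + t, x0 < c' < x0 + t, y0 < d' < y0 + t &
        gxy c d = gyx c' d'].
  move=> t0; have xt : x0 < x0 + t by rewrite ltrDl.
  have yt : y0 < y0 + t by rewrite ltrDl.
  have [c [c1 c2 Ec]] := @mean_value (fun x => g x (y0 + t) - g x y0) _ _ _ xt
    (fun x => is_derive_sub (Dx x (y0 + t)) (Dx x y0)).
  have [d [d1 d2 Ed]] := @mean_value (gx c) _ _ _ yt (Dxy c).
  have [d' [d'1 d'2 Ed']] := @mean_value (fun y => g (x0 + t) y - g x0 y) _ _ _ yt
    (fun y => is_derive_sub (Dy (x0 + t) y) (Dy x0 y)).
  have [c' [c'1 c'2 Ec']] := @mean_value (gy^~ d') _ _ _ xt (fun x => Dyx x d').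
  exists c, d, c', d'; split; rewrite ?c1 ?d1 ?c'1 ?d'1 //.
  have t2 : t * t != 0 by rewrite mulf_neq0 // gt_eqF.
  have tt w : w + t - w = t by ring.
  by apply: (mulIf t2); move: Ec Ed'; rewrite /= Ed Ec' !tt; lra.
apply/eqP; rewrite -subr_eq0 -normr_le0; apply/ler_addgt0Pl => e e0; rewrite addr0.
have e2 : 0 < e / 2 by rewrite divr_gt0.
move/cvgrPdist_lt/(_ _ e2) : cxy => cxy; move/cvgrPdist_lt/(_ _ e2) : cyx => cyx.
have [t /= t0 Ht] := iffLR (nbhs_ballP (x0, y0) _) (filterI cxy cyx).
have [c [d [c' [d' [/andP[? ?] /andP[? ?] /andP[? ?] /andP[? ?] E]]]]] := step t t0.
have /Ht[/= H1 _] : ball (x0, y0) t (c, d) by split; rewrite /= /ball /= ltr_distlC; lra.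
have /Ht[/= _ H2] : ball (x0, y0) t (c', d') by split; rewrite /= /ball /= ltr_distlC; lra.
rewrite E in H1.
rewrite distrC in H2.
by have := ler_distD (gyx c' d') (gxy x0 y0) (gyx x0 y0); lra.
Qed.

End RealFunctions.

(** * The maximum principle in a half-plane *)

Section HalfPlane.
Context {R : realType}.
Implicit Types (w v b c : R -> R -> R).

(** The data used by the maximum principle: the operators below have no mixed second-order term, and
    joint continuity provides maxima on compact rectangles. *)
Record jet2 w wr wrr wz wzz (r z : R) : Prop := Jet2 {
  jet_r : is_derive r 1 (w^~ z) (wr r z);
  jet_rr : is_derive r 1 (wr^~ z) (wrr r z);
  jet_z : is_derive z 1 (w r) (wz r z);
  jet_zz : is_derive z 1 (wz r) (wzz r z);
  jet_continuous : {for (r, z), continuous (fun x : R * R => w x.1 x.2)} }.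

Lemma jet2_sub w wr wrr wz wzz v vr vrr vz vzz r z :
  jet2 w wr wrr wz wzz r z -> jet2 v vr vrr vz vzz r z ->
  jet2 (fun r z => w r z - v r z) (fun r z => wr r z - vr r z)
    (fun r z => wrr r z - vrr r z) (fun r z => wz r z - vz r z)
    (fun r z => wzz r z - vzz r z) r z.
Proof.
case=> ? ? ? ? cw [? ? ? ? cv]; split; try exact: is_derive_sub.
exact: continuousB cw cv.
Qed.

Lemma jet2_scale (k : R) w wr wrr wz wzz r z :
  jet2 w wr wrr wz wzz r z ->
  jet2 (fun r z => k * w r z) (fun r z => k * wr r z) (fun r z => k * wrr r z)
    (fun r z => k * wz r z) (fun r z => k * wzz r z) r z.
Proof.
case=> ? ? ? ? cw; split; try exact: is_deriveZ.
exact: continuousM (@cst_continuous _ _ k _) cw.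
Qed.

(* With [L w = w_rr + c w_r + w_zz + b w_z], an interior maximum of [v - p]
   contradicts [L p < L v]. *)
Lemma comparison v vr vrr vz vzz p pr prr pz pzz b c (a z1 z2 rho : R) :
  0 < rho ->
  (forall r z, 0 < r <= a -> z1 <= z <= z2 ->
     jet2 v vr vrr vz vzz r z /\ jet2 p pr prr pz pzz r z) ->
  (forall r z, 0 < r <= a -> z1 <= z <= z2 ->
     [|| r <= rho, r == a, z == z1 | z == z2] -> v r z <= p r z) ->
  (forall r z, 0 < r < a -> z1 < z < z2 ->
     prr r z + c r z * pr r z + pzz r z + b r z * pz r z
       < vrr r z + c r z * vr r z + vzz r z + b r z * vz r z) ->
  forall r z, 0 < r <= a -> z1 <= z <= z2 -> v r z <= p r z.
Proof.
move=> rho0 J bd Lpv r1 zz1 r1I zz1I.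
case: (leP r1 rho) => [r1rho|rhor1]; first by apply: bd => //; rewrite r1rho.
rewrite leNgt; apply/negP => vp.
pose w (x : R * R) := v x.1 x.2 - p x.1 x.2.
(* The strip [r <= rho] belongs to the boundary data, so the maximum is sought on a compact
   rectangle away from the axis. *)
pose A := `[rho, a] `*` `[z1, z2] : set (R * R).
have AI x : A x -> 0 < x.1 <= a /\ z1 <= x.2 <= z2.
  case; rewrite /= !in_itv /= => /andP[? ?] ?; split=> //.
  by apply/andP; split=> //; lra.
have A1 : A (r1, zz1) by split; rewrite /= in_itv //= (ltW rhor1); case/andP: r1I.
have cA : compact A by apply: compact_setX; exact: segment_compact.
have cw : {within A, continuous w}.
  apply: continuous_in_subspaceT => x; rewrite inE => /AI[I1 I2].
  have [J1 J2] := J _ _ I1 I2; case: x {I1 I2} J1 J2 => x1 x2 J1 J2.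
  exact: (jet_continuous (jet2_sub J1 J2)).
have A0 : A !=set0 by exists (r1, zz1).
have [[r z] /[!inE] Arz wmax] := compact_EVT_max A0 cA cw.
have w0 : 0 < v r z - p r z.
  apply: lt_le_trans (wmax (r1, zz1) _); first by rewrite /w /= subr_gt0.
  by rewrite inE.
have [/= rI zI] := AI _ Arz.
have nb : ~~ [|| r <= rho, r == a, z == z1 | z == z2].
  by apply/negP => /(bd _ _ rI zI); rewrite leNgt -subr_gt0 w0.
move: nb; rewrite !negb_or -ltNge => /and4P[rhor ra zz1' zz2'].
have {}ra : r < a by rewrite lt_neqAle ra; case/andP: rI.
have {}zz1' : z1 < z by rewrite lt_neqAle eq_sym zz1'; case/andP: zI.
have {}zz2' : z < z2 by rewrite lt_neqAle zz2'; case/andP: zI.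
have r0 : 0 < r by apply: lt_trans rhor.
have Jw r' z' : 0 < r' <= a -> z1 <= z' <= z2 -> jet2 _ _ _ _ _ r' z' :=
  fun I I' => jet2_sub (J r' z' I I').1 (J r' z' I I').2.
have wmax' r' z' : rho <= r' <= a -> z1 <= z' <= z2 ->
    v r' z' - p r' z' <= v r z - p r z.
  by move=> ? ?; apply: (wmax (r', z')); rewrite inE; split; rewrite /= in_itv.
have [wr0 wrr0] : vr r z - pr r z = 0 /\ vrr r z - prr r z <= 0.
  pose d := Num.min (r - rho) (a - r).
  have d0 : 0 < d by rewrite lt_min !subr_gt0 rhor ra.
  have dI y : `|y - r| < d -> rho < y < a.
    by rewrite lt_min !ltr_distl => /andP[/andP[? ?] /andP[? ?]]; lra.
  apply: (@local_max_derive2 _ (fun r' => v r' z - p r' z)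
    (fun r' => vr r' z - pr r' z) _ r d d0).
  - move=> y /dI yI; apply: (jet_r (Jw y z _ zI)).
    by apply/andP; split; lra.
  - exact: (jet_rr (Jw r z rI zI)).
  - by move=> y /dI yI; apply: wmax' zI; lra.
have [wz0 wzz0] : vz r z - pz r z = 0 /\ vzz r z - pzz r z <= 0.
  pose d := Num.min (z - z1) (z2 - z).
  have d0 : 0 < d by rewrite lt_min !subr_gt0 zz1' zz2'.
  have dI y : `|y - z| < d -> z1 < y < z2.
    by rewrite lt_min !ltr_distl => /andP[/andP[? ?] /andP[? ?]]; lra.
  apply: (@local_max_derive2 _ (fun z' => v r z' - p r z')
    (fun z' => vz r z' - pz r z') _ z d d0).
  - move=> y /dI yI; apply: (jet_z (Jw r y rI _)).
    by apply/andP; split; lra.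
  - exact: (jet_zz (Jw r z rI zI)).
  - by move=> y /dI yI; apply: wmax'; lra.
have := Lpv r z; rewrite r0 ra zz1' zz2' => /(_ isT isT) H.
move/eqP: wr0; rewrite subr_eq0 => /eqP wr0; move/eqP: wz0; rewrite subr_eq0 => /eqP wz0.
by move: H; rewrite wr0 wz0 ltNge; lra.
Qed.

End HalfPlane.

(** * The barrier near a point of the axis *)

Section Barriers.
Context {R : realType}.

(** It vanishes at [z0 - 1] and [z0 + 1], where the barrier must dominate a multiple of [1 / r], and
    equals [1 / 10] at [z0], where the barrier must be bounded. The divisor 10 keeps the slope below
    [1 / 5], so that the drift in [z] can be absorbed. *)
Definition depth (z0 z : R) := (1 - (z - z0) ^+ 2) / 10.

(* Comparable to [1 / r] at [z = z0 +- 1], but bounded near [r = 0] for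
   [z = z0], up to the term in [eta], which will tend to [0]. *)
Definition bump (k eta z0 r z : R) := k * (r + depth z0 z)^-1 + eta * r^-1.
Definition bump_r (k eta z0 r z : R) :=
  - k * (r + depth z0 z) ^- 2 - eta * r ^- 2.
Definition bump_rr (k eta z0 r z : R) :=
  2 * k * (r + depth z0 z) ^- 3 + 2 * eta * r ^- 3.
Definition bump_z (k eta z0 r z : R) :=
  k * ((z - z0) / 5) * (r + depth z0 z) ^- 2.
Definition bump_zz (k eta z0 r z : R) :=
  k * (2 * ((z - z0) / 5) ^+ 2 * (r + depth z0 z) ^- 3
       + (r + depth z0 z) ^- 2 / 5).

Lemma bump_jet (k eta z0 r z : R) : 0 < r -> 0 < r + depth z0 z ->
  jet2 (bump k eta z0) (bump_r k eta z0) (bump_rr k eta z0) (bump_z k eta z0)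
    (bump_zz k eta z0) r z.
Proof.
rewrite /bump /bump_r /bump_rr /bump_z /bump_zz; set d := depth z0.
move=> r0 q0; have {}q0 : r + d z != 0 by rewrite gt_eqF.
have {}r0 : r != 0 by rewrite gt_eqF.
have Dr := is_derive_id r (1 : R).
have Dq : is_derive r 1 (fun r => r + d z) 1.
  by apply: (is_derive_eq (is_derive_add Dr (is_derive_const (d z) r))); ring.
have Ds : is_derive z 1 (fun z => z - z0) 1.
  by apply: (is_derive_eq (is_derive_sub (is_derive_id z 1) (is_derive_const z0 z))); ring.
have Dd : is_derive z 1 d (- ((z - z0) / 5)).
  rewrite /d /depth; apply: (is_derive_eq (is_derive_mul
    (is_derive_sub (is_derive_const 1 z) (is_derive_sqr Ds)) (is_derive_const (10^-1) z))).
  by field.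
have Dqz : is_derive z 1 (fun z => r + d z) (- ((z - z0) / 5)).
  by apply: (is_derive_eq (is_derive_add (is_derive_const r z) Dd)); ring.
split.
- apply: (is_derive_eq (is_derive_add
    (is_derive_mul (is_derive_const k r) (is_derive_inv Dq q0))
    (is_derive_mul (is_derive_const eta r) (is_derive_inv Dr r0)))).
  by field; rewrite r0 q0.
- apply: (is_derive_eq (is_derive_sub
    (is_derive_mul (is_derive_const (- k) r) (is_derive_inv_sqr Dq q0))
    (is_derive_mul (is_derive_const eta r) (is_derive_inv_sqr Dr r0)))).
  by field; rewrite r0 q0.
- apply: (is_derive_eq (is_derive_add
    (is_derive_mul (is_derive_const k z) (is_derive_inv Dqz q0))
    (is_derive_const (eta * r^-1) z))).
  by field; rewrite q0.
- apply: (is_derive_eq (is_derive_mul (is_derive_mul (is_derive_const k z)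
    (is_derive_mul Ds (is_derive_const (5^-1) z))) (is_derive_inv_sqr Dqz q0))).
  by field; rewrite q0.
- have c1 : {for (r, z), continuous (fst : R * R -> R)} by exact: cvg_fst.
  have c2 : {for (r, z), continuous (snd : R * R -> R)} by exact: cvg_snd.
  have cc (l : R) : {for (r, z), continuous (fun _ : R * R => l)} by exact: cst_continuous.
  apply: continuousD; apply: continuousM => //; apply: continuousV => //.
  apply: continuousD => //.
  by apply: (continuous_comp c2); exact: is_derive_continuous Dd.
Qed.

End Barriers.

(** * Bound near the axis from a bound on [r * v] *)

Section Bounds.
Context {R : realType}.
Implicit Types (v b ur : R -> R -> R).

(** Comparison with [bump (3 / 2 * e) eta z0] on the unit cylinder around [z0]. The bound [M] only
    determines how close to the axis the term in [eta] takes over, so it disappears from the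
    conclusion when [eta] tends to 0. *)
Lemma axis_bound v vr vrr vz vzz ur b (z0 e M : R) : 0 <= e ->
  (forall r z, 0 < r -> jet2 v vr vrr vz vzz r z) ->
  (forall r z, 0 < r ->
     vrr r z + (3 / r - ur r z) * vr r z + vzz r z + b r z * vz r z = 0) ->
  (forall r z, 0 < r <= 1 -> z0 - 1 <= z <= z0 + 1 ->
     [/\ ur r z <= 1 / 10, r * `|b r z| <= 3 / 10, r * v r z <= e & v r z <= M]) ->
  forall r, 0 < r <= 1 -> v r z0 <= 15 * e.
Proof.
move=> e0 J Lv bnd r1 r1I; have r10 : 0 < r1 by case/andP: r1I.
suff H eta : 0 < eta -> v r1 z0 <= 3 / 2 * e * (r1 + depth z0 z0)^-1 + eta * r1^-1.
  (* With [eta = d * r1] the last term is exactly [d]. Since [depth z0 z0 = 1 / 10], the first one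
     is at most [3 / 2 * e * 10 = 15 * e]. *)
  apply/ler_addgt0Pr => d d0; have := H _ (mulr_gt0 d0 r10).
  rewrite mulfK ?gt_eqF // => /le_trans; apply; rewrite lerD2r.
  rewrite /depth subrr expr0n /= subr0 ler_pdivrMr; last by rewrite addr_gt0 // divr_gt0.
  by nra.
(* For [r <= rho], the term [eta / r] alone exceeds [M], hence [v]. *)
move=> eta0; pose rho := eta / (`|M| + 1).
have M1 : 0 < `|M| + 1 by rewrite ltr_wpDl.
have rho0 : 0 < rho by rewrite divr_gt0.
have dge0 z : z0 - 1 <= z <= z0 + 1 -> 0 <= depth z0 z <= 1 / 10.
  rewrite /depth.
  move=> /andP[? ?]; have -> : 1 - (z - z0) ^+ 2 = (z0 + 1 - z) * (z - (z0 - 1)) by ring.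
  apply/andP; split; first by rewrite divr_ge0 // mulr_ge0 // subr_ge0.
  rewrite ler_pM2r ?invr_gt0 //.
  by have := sqr_ge0 (z - z0); nra.
have := @comparison R v vr vrr vz vzz (bump (3 / 2 * e) eta z0) (bump_r (3 / 2 * e) eta z0)
  (bump_rr (3 / 2 * e) eta z0) (bump_z (3 / 2 * e) eta z0) (bump_zz (3 / 2 * e) eta z0)
  b (fun r z => 3 / r - ur r z) 1 (z0 - 1) (z0 + 1) rho rho0.
apply=> [r z rI zI|r z rI zI|||].
- have r0 : 0 < r by case/andP: rI.
  split; first exact: J.
  apply: bump_jet => //.
  by case/andP: (dge0 _ zI) => ? _; rewrite ltr_wpDr.
- rewrite /bump; have r0 : 0 < r by case/andP: rI.
  have [_ _ rve vM] := bnd r z rI zI.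
  have [/andP[d0 d1]] := dge0 _ zI.
  set d := depth z0 z in d0 d1 *.
  have q0 : 0 < r + d by rewrite ltr_wpDr.
  have ve : v r z <= e * r^-1 by rewrite ler_pdivlMr // mulrC.
  have k0 : 0 <= 3 / 2 * e * (r + d)^-1 by rewrite mulr_ge0 ?invr_ge0 ?(ltW q0) //; lra.
  have er0 : 0 < eta * r^-1 by rewrite divr_gt0.
  (* On [r = 1] the depth costs at most a factor [11 / 10], and on the two caps it vanishes: the
     constant [3 / 2] covers both cases. *)
  case/or4P => [rrho|/eqP r1E|/eqP zE|/eqP zE].
  + rewrite (le_trans vM) // (le_trans _ (lerD k0 (lexx _))) // add0r ler_pdivlMr //.
    move: rrho; rewrite ler_pdivlMr // => rrho.
    rewrite (le_trans _ rrho) // mulrC ler_pM2l //.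
    by rewrite (le_trans (ler_norm _)) // lerDl.
  + rewrite (le_trans ve) // r1E invr1 mulr1.
    rewrite (@le_trans _ _ (3 / 2 * e * (1 + d)^-1)) //; last by rewrite lerDl mulr1 ltW.
    by rewrite ler_pdivlMr; nra.
  + have -> : d = 0 by rewrite /d /depth zE; field.
    rewrite addr0 (le_trans ve) // -mulrDl ler_pM2r ?invr_gt0 //; lra.
  + have -> : d = 0 by rewrite /d /depth zE; field.
    rewrite addr0 (le_trans ve) // -mulrDl ler_pM2r ?invr_gt0 //; lra.
- move=> r z /andP[r0 rlt1] /andP[z0z zz0]; rewrite Lv // => {Lv}.
  have zI : z0 - 1 <= z <= z0 + 1 by rewrite !ltW.
  have [|url rb _ _] := bnd r z _ zI; first by rewrite r0 ltW.
  have [/andP[d0 _]] := dge0 _ zI.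
  set d := depth z0 z in d0 *.
  have q0 : 0 < r + d by rewrite ltr_wpDr.
  rewrite /bump_r /bump_rr /bump_z /bump_zz -/d -!exprVn.
  set x := r^-1; set y := (r + d)^-1; set s := (z - z0) / 5.
  have x0 : 0 < x by rewrite invr_gt0.
  have y0 : 0 < y by rewrite invr_gt0.
  have x1 : 1 <= x by rewrite invf_ge1 // ltW.
  have yx : y <= x by rewrite lef_pV2 ?posrE // lerDl.
  have s1 : `|s| <= 1 / 5 by rewrite ler_norml /s; lra.
  have s2 : s ^+ 2 <= 1 / 25.
    by rewrite -real_normK ?num_real // (_ : 1 / 25 = (1 / 5) ^+ 2) ?lerXn2r ?nnegrE //; lra.
  have bs : b r z * s <= 3 / 50 * x.
    rewrite (le_trans (ler_norm _)) // normrM.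
    have : `|b r z| <= 3 / 10 * x by rewrite ler_pdivlMr // mulrC.
    by have := normr_ge0 (b r z); have := normr_ge0 s; nra.
  (* The operator applied to the barrier is the sum of the left-hand sides of [H2] and [H3]. Here
     [2 * y - 3 * x <= - x], and as [1 <= x] the other terms add up to at most [11 / 25 * x]. *)
  have H1 : 2 * y - 3 * x + ur r z + 2 * s ^+ 2 * y + 1 / 5 + b r z * s <= 0.
    by have := sqr_ge0 s; nra.
  have H2 : eta * x ^+ 2 * (ur r z - x) < 0.
    by rewrite pmulr_rlt0 ?mulr_gt0 ?exprn_gt0 //; lra.
  have H3 : 3 / 2 * e * y ^+ 2 *
     (2 * y - 3 * x + ur r z + 2 * s ^+ 2 * y + 1 / 5 + b r z * s) <= 0.
    by rewrite mulr_ge0_le0 // !mulr_ge0 // ?exprn_ge0 ?(ltW y0) //; lra.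
  have := ltr_leD H2 H3; rewrite addr0; apply: le_lt_trans.
  by rewrite le_eqVlt; apply/orP; left; apply/eqP; rewrite -/x; ring.
- exact: r1I.
- by apply/andP; split; lra.
Qed.

End Bounds.

(** * Maximum principle on rectangles touching the axis *)

Section RectangleBound.
Context {R : realType}.
Implicit Types (v b ur : R -> R -> R).

(* [1 / r] is a supersolution for small [r] only; the exponentials, with [A] large,
   compensate elsewhere. *)
Definition wall (K eta A a r z : R) := K + eta * (r^-1 + (expR (A * a) - expR (A * r))).
Definition wall_r (eta A r z : R) := eta * (- r ^- 2 - A * expR (A * r)).
Definition wall_rr (eta A r z : R) := eta * (2 * r ^- 3 - A ^+ 2 * expR (A * r)).

Lemma wall_jet (K eta A a r z : R) : 0 < r ->
  jet2 (wall K eta A a) (wall_r eta A) (wall_rr eta A) (fun=> fun=> 0)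
    (fun=> fun=> 0) r z.
Proof.
move=> r0; have {}r0 : r != 0 by rewrite gt_eqF.
have Did : is_derive r 1 id (1 : R) := is_derive_id r 1.
have DE : is_derive r 1 (fun r => expR (A * r)) (A * expR (A * r)).
  apply: (is_derive_eq (@is_derive1_comp _ expR (fun r => A * r) _ _ _
     (is_derive_expR _) (is_derive_mul (is_derive_const A r) Did))).
  by rewrite mul0r add0r mulr1 mulrC.
have Dw : is_derive r 1 ((wall K eta A a)^~ z) (wall_r eta A r z).
  apply: (is_derive_eq (is_derive_add (is_derive_const K r)
    (is_derive_mul (is_derive_const eta r)
    (is_derive_add (is_derive_inv Did r0)
       (is_derive_sub (is_derive_const (expR (A * a)) r) DE))))).
  by rewrite /wall_r; field.
split; first exact: Dw.
- have DN : is_derive r 1 (fun r => - r ^- 2) _ :=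
    is_deriveN (is_derive_inv_sqr Did r0).
  apply: (is_derive_eq (is_derive_mul (is_derive_const eta r)
    (is_derive_sub DN (is_derive_mul (is_derive_const A r) DE)))).
  by rewrite /wall_rr; field.
- exact: is_derive_const.
- exact: is_derive_const.
- have c1 : {for (r, z), continuous (fst : R * R -> R)} by exact: cvg_fst.
  exact: (continuous_comp (g := (wall K eta A a)^~ z) c1 (is_derive_continuous Dw)).
Qed.

(** The axis side of the rectangle carries no boundary condition: there [eta / r] dominates the
    bounded function [v], and [eta] then tends to 0. The barrier depends on [r] only, so the drift
    [b] drops out of the computation. *)
Lemma rectangle_bound v vr vrr vz vzz ur b (a z1 z2 K M U : R) : 0 <= U ->
  (forall r z, 0 < r -> jet2 v vr vrr vz vzz r z) ->
  (forall r z, 0 < r ->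
     vrr r z + (3 / r - ur r z) * vr r z + vzz r z + b r z * vz r z = 0) ->
  (forall r z, 0 < r <= a -> z1 <= z <= z2 -> ur r z <= U /\ v r z <= M) ->
  (forall r z, 0 < r <= a -> z1 <= z <= z2 ->
     [|| r == a, z == z1 | z == z2] -> v r z <= K) ->
  forall r z, 0 < r <= a -> z1 <= z <= z2 -> v r z <= K.
Proof.
move=> U0 J Lv bnd bd r1 zz1 r1I zz1I.
have [r10 r1a] := andP r1I.
(* The operator applied to the barrier is [eta] times [ur * x ^+ 2 - x ^+ 3 - A * E * (A + 3 * x -
   ur)], with [x = 1 / r] and [E = expR (A * r)]. Its first two terms are at most [U ^+ 3], while
   [A - ur] is at least [U ^+ 3 + 1]. *)
pose A := U ^+ 3 + U + 1.
have U3 : 0 <= U ^+ 3 by rewrite exprn_ge0.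
have A0 : 0 < A by rewrite /A; lra.
have ea r : r <= a -> 0 <= expR (A * a) - expR (A * r).
  by move=> ra; rewrite subr_ge0 ler_expR ler_pM2l.
suff H eta : 0 < eta -> v r1 zz1 <= K + eta * (r1^-1 + (expR (A * a) - expR (A * r1))).
  set s := r1^-1 + (expR (A * a) - expR (A * r1)) in H.
  have s0 : 0 < s by rewrite ltr_pwDl ?invr_gt0 // ea.
  by apply/ler_addgt0Pr => d d0; have := H _ (divr_gt0 d0 s0); rewrite divfK // gt_eqF.
move=> eta0.
have M1 : 0 < `|M - K| + 1 by rewrite ltr_wpDl.
have rho0 : 0 < eta / (`|M - K| + 1) by rewrite divr_gt0.
have := @comparison R v vr vrr vz vzz (wall K eta A a) (wall_r eta A) (wall_rr eta A)
  (fun=> fun=> 0) (fun=> fun=> 0) b (fun r z => 3 / r - ur r z) a z1 z2 _ rho0.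
apply=> [r z rI zI|r z rI zI|r z||]; last 2 first.
- exact: r1I.
- exact: zz1I.
- have r0 : 0 < r by case/andP: rI.
  by split; [exact: J | exact: wall_jet].
- have [r0 ra] := andP rI; have [_ vM] := bnd r z rI zI.
  have s0 : 0 <= eta * (expR (A * a) - expR (A * r)) by rewrite mulr_ge0 ?ea // ltW.
  have er0 : 0 < eta * r^-1 by rewrite divr_gt0.
  case/orP => [rrho|/(bd _ _ rI zI) vK]; last by rewrite /wall mulrDr; lra.
  suff : M - K <= eta * r^-1 by rewrite /wall mulrDr; lra.
  rewrite ler_pdivlMr //; move: rrho; rewrite ler_pdivlMr // => rrho.
  rewrite (le_trans _ rrho) // mulrC ler_pM2l //.
  by rewrite (le_trans (ler_norm _)) // lerDl.
- move=> /andP[r0 rlta] /andP[z1z zz2]; rewrite Lv // => {Lv}.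
  have zI : z1 <= z <= z2 by rewrite !ltW.
  have [|url _] := bnd r z _ zI; first by rewrite r0 ltW.
  rewrite /wall_r /wall_rr -!exprVn; set x := r^-1; set E := expR (A * r).
  have x0 : 0 < x by rewrite invr_gt0.
  have E1 : 1 <= E by rewrite -expR0 ler_expR mulr_ge0 // ltW.
  (* For [U <= x] the left-hand side is nonpositive; otherwise its first term is at most
     [U ^+ 3]. *)
  have H1 : U * x ^+ 2 - x ^+ 3 <= U ^+ 3.
    case: (leP U x) => Ux.
      by have := mulr_ge0 (sqr_ge0 x) (_ : 0 <= x - U); rewrite subr_ge0 => /(_ Ux); lra.
    have x2 : x ^+ 2 <= U ^+ 2 by rewrite lerXn2r ?nnegrE // ltW.
    have := ler_wpM2l U0 x2; have := exprn_gt0 3 x0.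
    by rewrite (exprS U 2); lra.
  have H2 : ur r z * x ^+ 2 <= U * x ^+ 2 by rewrite ler_wpM2r ?sqr_ge0.
  have H3 : U ^+ 3 + 1 <= A + 3 * x - ur r z by rewrite /A; lra.
  have H4 : 1 <= A * E by rewrite (le_trans E1) // ler_peMl /A; lra.
  have H5 : U ^+ 3 + 1 <= A * E * (A + 3 * x - ur r z).
    by rewrite (le_trans H3) // ler_peMl //; lra.
  have H6 : eta * (ur r z * x ^+ 2 - x ^+ 3 - A * E * (A + 3 * x - ur r z)) < 0.
    by rewrite pmulr_rlt0 //; lra.
  apply: le_lt_trans H6.
  by rewrite le_eqVlt; apply/orP; left; apply/eqP; ring.
Qed.

End RectangleBound.

(** * Liouville theorem in the half-plane *)

Section Liouville.
Context {R : realType}.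
Implicit Types (v b ur : R -> R -> R).

(** On the boundary of a large rectangle [v] is at most [15 * e]: by decay where [1 <= r], and by
    [axis_bound] on the parts of the caps near the axis. The bound [rectangle_bound] carries this
    inside, and [e] is arbitrary. *)
Lemma decaying_subsolution_le0 v vr vrr vz vzz ur b :
  (forall r z, 0 < r -> jet2 v vr vrr vz vzz r z) ->
  (forall r z, 0 < r ->
     vrr r z + (3 / r - ur r z) * vr r z + vzz r z + b r z * vz r z = 0) ->
  (forall a, exists M, forall r z, 0 < r <= a -> `|z| <= a ->
     `|ur r z| <= M /\ `|v r z| <= M) ->
  (forall e, 0 < e -> exists A, forall r z, 0 < r -> A < Num.max r `|z| ->
     [/\ `|ur r z| <= e, r * `|v r z| <= e & (r <= 1 -> r * `|b r z| <= e)]) ->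
  forall r z, 0 < r -> v r z <= 0.
Proof.
move=> J Lv bnd decay r1 zz1 r10.
suff H e : 0 < e -> e <= 1 / 10 -> v r1 zz1 <= 15 * e.
  rewrite leNgt; apply/negP => v0.
  (* With this choice [15 * e] is at most half of the positive value [v r1 zz1]. *)
  pose e := Num.min (1 / 10) (v r1 zz1 / 30).
  have e0 : 0 < e by rewrite lt_min !divr_gt0.
  have e1 : e <= 1 / 10 by rewrite ge_min lexx.
  have e2 : e <= v r1 zz1 / 30 by rewrite ge_min lexx orbT.
  by have := H e e0 e1; lra.
move=> e0 e1; have [A HA] := decay e e0.
(* The rectangle contains the given point, and even at height [a - 1] the decay estimates hold,
   which the unit cylinders centred on the caps require. *)
pose a := Num.max A 0 + r1 + `|zz1| + 3.
have mA : A <= Num.max A 0 by rewrite le_max lexx.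
have m0 : 0 <= Num.max A 0 by rewrite le_max lexx orbT.
have nz := normr_ge0 zz1.
have [M HM] := bnd a.
have M0 : 0 <= M.
  have [||H _] := HM r1 zz1; [by apply/andP; split; rewrite /a; lra|by rewrite /a; lra|].
  exact: le_trans H.
have zI z : - a <= z <= a -> `|z| <= a by rewrite ler_norml.
have far r z : 1 <= r -> A < Num.max r `|z| -> v r z <= 15 * e.
  move=> r1' /HA; rewrite (lt_le_trans ltr01 r1') => /(_ isT)[_ rv _].
  have : v r z <= r * `|v r z|.
    by rewrite (le_trans (ler_norm _)) // ler_peMl.
  by lra.
have caps r z : 0 < r -> `|z| = a -> v r z <= 15 * e.
  move=> r0 za; case: (leP 1 r) => r1'.
    by apply: far => //; rewrite lt_max za; apply/orP; right; rewrite /a; lra.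
  have rI : 0 < r <= 1 by rewrite r0 ltW.
  (* The cylinder around a cap extends beyond the rectangle, up to height [a + 1]. *)
  have [M' HM'] := bnd (a + 1).
  apply: (@axis_bound R v vr vrr vz vzz ur b z e M' (ltW e0) J Lv _ r rI).
  move=> r' z' /andP[r'0 r'1] z'I.
  have z'a : a - 1 <= `|z'| <= a + 1.
    have : `|z - z'| <= 1 by rewrite ler_norml; lra.
    have := ler_normD (z - z') z'; have := ler_normB z (z - z').
    by rewrite subKr subrK za; lra.
  have [||ue ve be] := HA r' z'; first by [].
    by rewrite lt_max; apply/orP; right; rewrite /a in z'a; lra.
  have [||_ vM] := HM' r' z'; [by apply/andP; split; rewrite /a; lra|lra|].
  split.
  - by rewrite (le_trans (ler_norm _)) //; lra.
  - by rewrite (le_trans (be r'1)) //; lra.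
  - by rewrite (le_trans _ ve) // ler_pM2l // ler_norm.
  - by rewrite (le_trans (ler_norm _)).
apply: (@rectangle_bound R v vr vrr vz vzz ur b a (- a) a (15 * e) M M M0 J Lv).
- move=> r z rI /zI za; have [uM vM] := HM r z rI za.
  by split; apply: le_trans (ler_norm _) _.
- move=> r z /andP[r0 _] _ /or3P[/eqP ra|/eqP za|/eqP za].
  + by apply: far; rewrite ?lt_max ra /a; [|apply/orP; left]; lra.
  + by apply: caps => //; rewrite za normrN ger0_norm // /a; lra.
  + by apply: caps => //; rewrite za ger0_norm // /a; lra.
- by rewrite r10 /a; lra.
- by rewrite -ler_norml /a; lra.
Qed.

(** Once the drift [2 * P - uz] is regarded as a given coefficient, the equation is linear, and both
    [P] and [- P] solve it; each of them is therefore nonpositive. *)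
Lemma half_plane_liouville P Pr Prr Pz Pzz ur uz :
  (forall r z : R, 0 < r -> jet2 P Pr Prr Pz Pzz r z) ->
  (forall r z, 0 < r ->
     Prr r z + (3 / r - ur r z) * Pr r z + Pzz r z
       + (2 * P r z - uz r z) * Pz r z = 0) ->
  (forall a, exists M, forall r z, 0 < r <= a -> `|z| <= a ->
     `|ur r z| <= M /\ `|P r z| <= M) ->
  (forall e, 0 < e -> exists A, forall r z, 0 < r -> A < Num.max r `|z| ->
     [/\ `|ur r z| <= e, `|uz r z| <= e & r * `|P r z| <= e]) ->
  forall r z, 0 < r -> P r z = 0.
Proof.
move=> J LP bnd decay r z r0.
have {}decay e : 0 < e -> exists A, forall r z, 0 < r -> A < Num.max r `|z| ->
    [/\ `|ur r z| <= e, r * `|P r z| <= e &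
      (r <= 1 -> r * `|2 * P r z - uz r z| <= e)].
  (* Two thirds of [e] go to [2 * (r * P)] and one third to [r * uz], where [r <= 1] is used. *)
  move=> e0; have e30 : 0 < e / 3 by rewrite divr_gt0.
  have [A HA] := decay _ e30; exists A => r' z' r'0 /(HA _ _ r'0)[ue uze Pe].
  split; [lra|lra|move=> r'1].
  have H : `|2 * P r' z' - uz r' z'| <= 2 * `|P r' z'| + `|uz r' z'|.
    by rewrite (le_trans (ler_normB _ _)) // normrM ger0_norm.
  have := ler_wpM2l (ltW r'0) H; have := normr_ge0 (uz r' z').
  by nra.
apply/eqP; rewrite eq_le; apply/andP; split.
  exact: (decaying_subsolution_le0 J LP bnd decay).
rewrite -oppr_le0 -mulN1r.
apply: (decaying_subsolution_le0 (fun r z r0 => jet2_scale (-1) (J r z r0))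
  (ur := ur) (b := fun r z => 2 * P r z - uz r z)) => // {r z r0}.
- by move=> r z r0; have := LP r z r0; lra.
- move=> a; have [M HM] := bnd a; exists M => r z rI zI.
  by rewrite mulN1r normrN; exact: HM.
- move=> e /decay[A HA]; exists A => r z r0 rA.
  by rewrite mulN1r normrN; exact: HA.
Qed.

End Liouville.

(** * Smooth fields on a meridian half-plane *)

Section Fields.
Context {R : realType}.
Local Notation V := 'rV[R]_3.

Lemma row3E (a b c : R) :
  [/\ row3 a b c 0 0 = a, row3 a b c 0 1 = b & row3 a b c 0 2 = c].
Proof. by split; rewrite mxE. Qed.

Lemma row3_eta (x : V) : x = row3 (x 0 0) (x 0 1) (x 0 2).
Proof.
apply/rowP => j; rewrite mxE.
by case: j => [] [|[|[|//]]] Hj /=; congr (x _ _); apply: val_inj.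
Qed.

Lemma row3_delta (a b c : R) :
  row3 a b c = a *: delta_mx 0 0 + b *: delta_mx 0 1 + c *: delta_mx 0 2.
Proof.
apply/rowP => j; rewrite !mxE.
by case: j => [] [|[|[|//]]] Hj /=; rewrite ?(mulr1, mulr0, addr0, add0r).
Qed.

Lemma is_derive_curve (g : V -> R) (a b c : R -> R) (t da db dc : R) :
  differentiable g (row3 (a t) (b t) (c t)) ->
  is_derive t 1 a da -> is_derive t 1 b db -> is_derive t 1 c dc ->
  is_derive t 1 (fun t => g (row3 (a t) (b t) (c t)))
    (da * partial 0 g (row3 (a t) (b t) (c t))
     + db * partial 1 g (row3 (a t) (b t) (c t))
     + dc * partial 2 g (row3 (a t) (b t) (c t))).
Proof.
move=> Dg Da Db Dc; pose y t := row3 (a t) (b t) (c t).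
have entry j : is_derive t 1 (fun t => y t 0 j) ([:: da; db; dc]`_j).
  rewrite /y; under eq_fun do rewrite mxE.
  by case: j => [] [|[|[|//]]] Hj.
have Dy : derivable y t 1 by apply/derivable_mxP => i j; rewrite ord1; have [] := entry j.
have dy : 'D_1 y t = row3 da db dc.
  rewrite derive_mx //; apply/rowP => j; rewrite !mxE.
  by have [_ ->] := entry j.
have Dy' : differentiable y t by exact/derivable1_diffP.
have Dgy : differentiable (g \o y) t by exact: differentiable_comp.
have D1 : derivable (g \o y) t 1 by exact/derivable1_diffP.
apply: (@DeriveDef _ _ _ _ _ (g \o y)) => //.
rewrite deriveE // diff_comp // /= -(deriveE _ Dy') dy row3_delta.
by rewrite !linearD !linearZ /= -!deriveE.
Qed.

Lemma derive_entry (w : V -> V) (k : 'I_3) (v x : V) : differentiable w x ->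
  'D_v w x 0 k = 'D_v (fun y => w y 0 k) x.
Proof. by move=> Dw; rewrite derive_mx ?mxE //; exact: diff_derivable. Qed.

Lemma iter_partial_entry (w : V -> V) (k : 'I_3) (s : seq 'I_3) : smooth w ->
  iter_partial s (fun y => w y 0 k) = fun y => iter_partial s w y 0 k.
Proof.
move=> sw; elim: s => //= j s ->; apply/funext => x.
by rewrite /partial derive_entry //; exact: sw.
Qed.

Lemma smooth_entry (w : V -> V) (k : 'I_3) : smooth w -> smooth (fun y => w y 0 k).
Proof.
move=> sw s x; rewrite iter_partial_entry //.
by apply: (differentiable_comp (g := fun A : V => A 0 k) (sw s x));
  exact: differentiable_coord.
Qed.

Lemma smooth_partial (g : V -> R) (j : 'I_3) : smooth g -> smooth (partial j g).
Proof.
move=> sg s; have := sg (rcons s j).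
by rewrite /iter_partial foldr_rcons.
Qed.

Lemma smooth_differentiable (g : V -> R) x : smooth g -> differentiable g x.
Proof. by move=> /(_ [::] x). Qed.

End Fields.

(** * Restriction to the plane of angle 0, and angular derivatives *)

Section Meridian.
Context {R : realType}.
Local Notation V := 'rV[R]_3.

Lemma is_derive_meridian_r (g : V -> R) (r z : R) : smooth g ->
  is_derive r 1 (fun r => g (row3 r 0 z)) (partial 0 g (row3 r 0 z)).
Proof.
move=> sg.
apply: (is_derive_eq (is_derive_curve (smooth_differentiable _ sg)
  (is_derive_id r 1) (is_derive_const 0 r) (is_derive_const z r))).
by rewrite !mul0r mul1r !addr0.
Qed.

Lemma is_derive_meridian_z (g : V -> R) (r z : R) : smooth g ->
  is_derive z 1 (fun z => g (row3 r 0 z)) (partial 2 g (row3 r 0 z)).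
Proof.
move=> sg.
apply: (is_derive_eq (is_derive_curve (smooth_differentiable _ sg)
  (is_derive_const r z) (is_derive_const 0 z) (is_derive_id z 1))).
by rewrite !mul0r mul1r !add0r.
Qed.

Lemma meridian_continuous (g : V -> R) (x : R * R) : smooth g ->
  {for x, continuous (fun x : R * R => g (row3 x.1 0 x.2))}.
Proof.
move=> sg.
have c1 : {for x, continuous (fst : R * R -> R)} by exact: cvg_fst.
have c2 : {for x, continuous (snd : R * R -> R)} by exact: cvg_snd.
have cr : {for x, continuous (fun x : R * R => x.1 *: delta_mx 0 0 + x.2 *: delta_mx 0 2 : V)}.
  by apply: cvgD; apply: cvgZl.
have -> : (fun x : R * R => g (row3 x.1 0 x.2)) =
    g \o (fun x : R * R => x.1 *: delta_mx 0 0 + x.2 *: delta_mx 0 2 : V).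
  by apply/funext => y; rewrite /= row3_delta scale0r addr0.
by apply: (continuous_comp cr); exact/differentiable_continuous/smooth_differentiable.
Qed.

(** Negative [r] are included because the bound on [h_theta / r] relies on a mean value on the
    segment from [- r] to [r]. *)
Lemma meridian_bounded (g : V -> R) (a : R) : smooth g ->
  exists M, forall r z, `|r| <= a -> `|z| <= a -> `|g (row3 r 0 z)| <= M.
Proof.
move=> sg; have [a0|a0] := ltP a 0.
  by exists 0 => r z ra; have := normr_ge0 r; lra.
pose A := `[- a, a] `*` `[- a, a] : set (R * R).
have AE r z : A (r, z) <-> `|r| <= a /\ `|z| <= a.
  by rewrite /A /setX /= !in_itv /= !ler_norml.
have cA : compact A by apply: compact_setX; exact: segment_compact.
have A0 : A !=set0 by exists (0, 0); apply/AE; rewrite normr0.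
have cg : {within A, continuous (fun x : R * R => `|g (row3 x.1 0 x.2)|)}.
  apply: continuous_subspaceT => x.
  by apply: (continuous_comp (meridian_continuous sg)); exact: norm_continuous.
have [c _ Hc] := compact_EVT_max A0 cA cg.
exists `|g (row3 c.1 0 c.2)| => r z ra za; apply: (Hc (r, z)).
by rewrite inE; apply/AE.
Qed.

Lemma mixed_partials_meridian (g : V -> R) (r z : R) : smooth g ->
  partial 2 (partial 0 g) (row3 r 0 z) = partial 0 (partial 2 g) (row3 r 0 z).
Proof.
move=> sg; have s0 := smooth_partial 0 sg; have s2 := smooth_partial 2 sg.
apply: (@mixed_partials R (fun r z => g (row3 r 0 z))
  (fun r z => partial 0 g (row3 r 0 z)) (fun r z => partial 2 g (row3 r 0 z))
  (fun r z => partial 2 (partial 0 g) (row3 r 0 z))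
  (fun r z => partial 0 (partial 2 g) (row3 r 0 z)) r z).
- by move=> x y; exact: is_derive_meridian_r.
- by move=> x y; exact: is_derive_meridian_z.
- by move=> x y; exact: is_derive_meridian_z.
- by move=> x y; exact: is_derive_meridian_r.
- exact: meridian_continuous (smooth_partial 2 s0).
- exact: meridian_continuous (smooth_partial 0 s2).
Qed.

Lemma cyl_point0 (r z : R) : cyl_point r 0 z = row3 r 0 z.
Proof. by rewrite /cyl_point cos0 sin0 mulr1 mulr0. Qed.

(* At [theta = 0], the derivatives of [g (cyl_point r theta z)] in [theta] of
   orders 1 and 2 are [r d_2 g] and [r^2 d_2^2 g - r d_1 g]. *)
Lemma angular_partials (g : V -> R) (r z A B : R) : 0 < r -> smooth g ->
  (forall theta, g (cyl_point r theta z) = A * cos theta + B * sin theta) ->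
  partial 1 g (row3 r 0 z) = B / r /\
  partial 1 (partial 1 g) (row3 r 0 z) = (r * partial 0 g (row3 r 0 z) - A) / r ^+ 2.
Proof.
move=> r0 sg Eg; have {}r0 : r != 0 by rewrite gt_eqF.
have Dcyl (f : V -> R) (t : R) : smooth f -> is_derive t 1 (fun t => f (cyl_point r t z))
    (- (r * sin t) * partial 0 f (cyl_point r t z)
     + r * cos t * partial 1 f (cyl_point r t z)).
  move=> sf; apply: (is_derive_eq (is_derive_curve (smooth_differentiable _ sf)
    (is_derive_mul (is_derive_const r t) (is_derive_cos t))
    (is_derive_mul (is_derive_const r t) (is_derive_sin t))
    (is_derive_const z t))).
  (* [ring] and [lra] are slow on atoms that unfold to limits: the partial
     derivatives are generalized first, here and below. *)
  rewrite -/(cyl_point r t z).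
  by move: (partial 0 f _) (partial 1 f _) (partial 2 f _) => f0 f1 f2; ring.
have D1 t : - (r * sin t) * partial 0 g (cyl_point r t z)
     + r * cos t * partial 1 g (cyl_point r t z) = - A * sin t + B * cos t.
  apply: is_derive_unique (Dcyl g t sg) _; under eq_fun do rewrite Eg.
  apply: (is_derive_eq (is_derive_add (is_derive_mul (is_derive_const A t) (is_derive_cos t))
    (is_derive_mul (is_derive_const B t) (is_derive_sin t)))).
  by ring.
have s0 := smooth_partial 0 sg; have s1 := smooth_partial 1 sg.
have H1 : r * partial 1 g (row3 r 0 z) = B.
  have := D1 0; rewrite cyl_point0 cos0 sin0.
  by move: (partial 0 g _) (partial 1 g _) => g0 g1; lra.
split; first by rewrite -H1; field.
have Ds : is_derive (0 : R) 1 (fun t => - (r * sin t)) (- r).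
  have D := is_derive_mul (is_derive_const r 0) (is_derive_sin 0).
  by apply: (is_derive_eq (is_deriveN D)); rewrite cos0; ring.
have D2 : is_derive (0 : R) 1 (fun t => - (r * sin t) * partial 0 g (cyl_point r t z)
     + r * cos t * partial 1 g (cyl_point r t z)) _ :=
  is_derive_add (is_derive_mul Ds (Dcyl _ 0 s0))
    (is_derive_mul (is_derive_mul (is_derive_const r 0) (is_derive_cos 0)) (Dcyl _ 0 s1)).
(* The first-order identity [D1] holds at every angle, so it may be differentiated once more at
   angle 0; the mixed derivatives there carry the factor [sin 0]. *)
rewrite (funext D1) in D2.
have := is_derive_unique D2 (is_derive_add
    (is_derive_mul (is_derive_const (- A) 0) (is_derive_sin 0))
    (is_derive_mul (is_derive_const B 0) (is_derive_cos 0))).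
rewrite cyl_point0 cos0 sin0 => H2.
have r2 : r ^+ 2 != 0 by rewrite expf_neq0.
move: H2; move: (partial 1 (partial 1 g) _) (partial 0 (partial 1 g) _).
move: (partial 1 (partial 0 g) _) (partial 0 (partial 0 g) _).
move: (partial 0 g _) (partial 1 g _) => g0 g1 g00 g01 g11 g10 H2.
by rewrite -[LHS](mulfK r2); congr (_ / _); lra.
Qed.

End Meridian.

(** * The azimuthal component of the Hall-MHD equations *)

Section Azimuthal.
Context {R : realType} (u h : 'rV[R]_3 -> 'rV[R]_3) (p : 'rV[R]_3 -> R).
Context (u_smooth : smooth u) (h_smooth : smooth h) (sol : steady_hall_mhd u h p).
Context (u_r u_theta u_z h_theta : R -> R -> R).
Context (u_form : forall r theta z : R, 0 < r ->
     u (cyl_point r theta z) =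
       u_r r z *: e_r theta + u_theta r z *: e_theta theta + u_z r z *: e_z).
Context (h_form : forall r theta z : R, 0 < r ->
     h (cyl_point r theta z) = h_theta r z *: e_theta theta).

Local Notation h0 := (fun y => h y 0 0).
Local Notation h1 := (fun y => h y 0 1).
Local Notation h2 := (fun y => h y 0 2).
Local Notation u1 := (fun y => u y 0 1).

(** The Cartesian components of [h] on a circle around the axis, in the form
    [A * cos theta + B * sin theta] that [angular_partials] expects. *)
Lemma h_cyl r theta z : 0 < r ->
  [/\ h (cyl_point r theta z) 0 0 = 0 * cos theta + - h (row3 r 0 z) 0 1 * sin theta,
      h (cyl_point r theta z) 0 1 = h (row3 r 0 z) 0 1 * cos theta + 0 * sin theta &
      h (cyl_point r theta z) 0 2 = 0 * cos theta + 0 * sin theta].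
Proof.
move=> r0; rewrite -cyl_point0 !h_form // !mxE /= cos0.
by split; ring.
Qed.

Lemma h_meridian r z : 0 < r -> h (row3 r 0 z) 0 0 = 0 /\ h (row3 r 0 z) 0 2 = 0.
Proof.
move=> r0; rewrite -cyl_point0; have [-> _ ->] := h_cyl 0 z r0.
by rewrite sin0 cos0; split; ring.
Qed.

Lemma u1_cyl r theta z : 0 < r ->
  u (cyl_point r theta z) 0 1 =
    u (row3 r 0 z) 0 1 * cos theta + u (row3 r 0 z) 0 0 * sin theta.
Proof.
by move=> r0; rewrite -cyl_point0 !u_form // !mxE /= cos0 sin0; ring.
Qed.

Lemma angular_partials_h r z : 0 < r ->
  [/\ partial 1 h0 (row3 r 0 z) = - h (row3 r 0 z) 0 1 / r,
      partial 1 h1 (row3 r 0 z) = 0, partial 1 h2 (row3 r 0 z) = 0 &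
      partial 1 (partial 1 h1) (row3 r 0 z) =
        (r * partial 0 h1 (row3 r 0 z) - h (row3 r 0 z) 0 1) / r ^+ 2].
Proof.
move=> r0.
have [-> _] := angular_partials r0 (smooth_entry 0 h_smooth)
  (fun theta => let: And3 e _ _ := h_cyl theta z r0 in e).
have [-> ->] := angular_partials r0 (smooth_entry 1 h_smooth)
  (fun theta => let: And3 _ e _ := h_cyl theta z r0 in e).
have [-> _] := angular_partials r0 (smooth_entry 2 h_smooth)
  (fun theta => let: And3 _ _ e := h_cyl theta z r0 in e).
by rewrite mul0r.
Qed.

Lemma curlE (w : 'rV[R]_3 -> 'rV[R]_3) (x : 'rV[R]_3) : differentiable w x ->
  [/\ curl w x 0 0 = partial 1 (fun y => w y 0 2) x - partial 2 (fun y => w y 0 1) x,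
      curl w x 0 1 = partial 2 (fun y => w y 0 0) x - partial 0 (fun y => w y 0 2) x &
      curl w x 0 2 = partial 0 (fun y => w y 0 1) x - partial 1 (fun y => w y 0 0) x].
Proof.
by move=> Dw; rewrite /curl /partial; split; rewrite mxE /=; congr (_ - _);
  exact: derive_entry.
Qed.

(* [curl (curl h x h)] has no second-order terms: they cancel by symmetry of the
   mixed derivatives. *)
Lemma hall_term r z : 0 < r ->
  curl (fun y => cross (curl h y) (h y)) (row3 r 0 z) 0 1
    = - (2 * h (row3 r 0 z) 0 1 * partial 2 h1 (row3 r 0 z) / r).
Proof.
move=> r0; set F := fun y => _; set x := row3 r 0 z.
have sm k : smooth (fun y => h y 0 k) := smooth_entry k h_smooth.
have smp j k : smooth (partial j (fun y => h y 0 k)) := smooth_partial j (sm k).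
have dm k y : differentiable (fun y => h y 0 k) y := smooth_differentiable y (sm k).
have dmp j k y : differentiable (partial j (fun y => h y 0 k)) y :=
  smooth_differentiable y (smp j k).
have hE y : [/\ curl h y 0 0 = partial 1 h2 y - partial 2 h1 y,
    curl h y 0 1 = partial 2 h0 y - partial 0 h2 y &
    curl h y 0 2 = partial 0 h1 y - partial 1 h0 y].
  by apply: curlE; exact: (h_smooth [::]).
pose F0 y := (partial 2 h0 y - partial 0 h2 y) * h2 y
    - (partial 0 h1 y - partial 1 h0 y) * h1 y.
pose F1 y := (partial 0 h1 y - partial 1 h0 y) * h0 y
    - (partial 1 h2 y - partial 2 h1 y) * h2 y.
pose F2 y := (partial 1 h2 y - partial 2 h1 y) * h1 y
    - (partial 2 h0 y - partial 0 h2 y) * h0 y.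
have F0E : (fun y => F y 0 0) = F0.
  by apply/funext => y; rewrite /F0 /F /cross mxE /=; have [_ -> ->] := hE y.
have F1E : (fun y => F y 0 1) = F1.
  by apply/funext => y; rewrite /F1 /F /cross mxE /=; have [-> _ ->] := hE y.
have F2E : (fun y => F y 0 2) = F2.
  by apply/funext => y; rewrite /F2 /F /cross mxE /=; have [-> -> _] := hE y.
have DF0 : differentiable F0 x.
  by apply: differentiableB; apply: differentiableM => //; exact: differentiableB.
have DF1 : differentiable F1 x.
  by apply: differentiableB; apply: differentiableM => //; exact: differentiableB.
have DF2 : differentiable F2 x.
  by apply: differentiableB; apply: differentiableM => //; exact: differentiableB.
(* Derivability of the vector field is obtained entrywise; it allows the partial derivatives in the
   curl to be taken entry by entry. *)
have DF v : derivable F x v.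
  apply/derivable_mxP => i k; rewrite (ord1 i).
  suff : differentiable (fun y => F y 0 k) x by exact: diff_derivable.
  case: k => [] [|[|[|//]]] Hk.
  - by rewrite (_ : Ordinal Hk = 0) ?F0E //; apply: val_inj.
  - by rewrite (_ : Ordinal Hk = 1) ?F1E //; apply: val_inj.
  - by rewrite (_ : Ordinal Hk = 2) ?F2E //; apply: val_inj.
have -> : curl F x 0 1 = partial 2 F0 x - partial 0 F2 x.
  by rewrite /curl mxE /= /partial !derive_mx // !mxE F0E F2E.
(* Only derivatives within the meridian plane remain, so [F0] may be simplified there before
   differentiating: [h0] and [h2] vanish and [partial 1 h0] is [- h1 / r]. The same is done for
   [F2]. *)
have P2F0 : partial 2 F0 x = - ((partial 2 (partial 0 h1) x + partial 2 h1 x / r) * h1 x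
    + (partial 0 h1 x + h1 x / r) * partial 2 h1 x).
  have D1 := is_derive_curve DF0 (is_derive_const r z) (is_derive_const 0 z)
    (is_derive_id z 1).
  have D2 := is_deriveN (is_derive_mul (is_derive_add
    (is_derive_meridian_z r z (smp 0 1)) (is_derive_mul (is_derive_meridian_z r z (sm 1))
    (is_derive_const r^-1 z))) (is_derive_meridian_z r z (sm 1))).
  have E : (fun t => F0 (row3 r 0 t)) =
     - (fun t => (partial 0 h1 (row3 r 0 t) + h1 (row3 r 0 t) / r) * h1 (row3 r 0 t)).
    apply/funext => t; rewrite /F0 [RHS]/GRing.opp /=.
    have [e0 e2] := h_meridian t r0; have [-> _ _ _] := angular_partials_h t r0.
    by rewrite e2; move: (partial _ _ _) (partial _ _ _) (partial _ _ _) => a b c; ring.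
  rewrite E in D1; have := is_derive_unique D1 D2; rewrite -/x /=.
  move: (partial 2 _ _) (partial 0 _ _) (partial 2 _ _)
    (partial 2 F0 _) (partial 1 F0 _) (partial 0 F0 _) => a b c d e f H.
  by rewrite !mul0r mul1r !add0r in H; rewrite H; ring.
have P0F2 : partial 0 F2 x = - (partial 0 (partial 2 h1) x * h1 x
    + partial 2 h1 x * partial 0 h1 x).
  have D1 := is_derive_curve DF2 (is_derive_id r 1) (is_derive_const 0 r)
    (is_derive_const z r).
  have D2 := is_deriveN (is_derive_mul (is_derive_meridian_r r z (smp 2 1))
     (is_derive_meridian_r r z (sm 1))).
  (* The simplification is available for positive radii only, hence as an identity near [r]. *)
  have E : \near r, (- (fun t => partial 2 h1 (row3 t 0 z) * h1 (row3 t 0 z))) r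
      = F2 (row3 r 0 z).
    near=> t; have t0 : 0 < t by near: t; exact: lt_nbhsr.
    rewrite /F2 [LHS]/GRing.opp /=.
    have [e0 e2] := h_meridian z t0; have [_ _ -> _] := angular_partials_h z t0.
    by rewrite e0; move: (partial _ _ _) (partial _ _ _) (partial _ _ _) => a b c; ring.
  have := is_derive_unique D1 (near_eq_is_derive E D2); rewrite -/x /=.
  move: (partial 2 _ _) (partial 0 _ _) (partial 0 _ _)
    (partial 2 F2 _) (partial 1 F2 _) (partial 0 F2 _) => a b c d e f H.
  by rewrite !mul0r mul1r !addr0 in H; rewrite H; ring.
rewrite P2F0 P0F2 mixed_partials_meridian //.
by move: (partial 0 _ _) (partial 0 _ _) (partial 2 _ _) => a b c; rewrite /x; ring.
Unshelve. all: by end_near. Qed.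

Lemma sum_ord3 (F : 'I_3 -> R) : \sum_j F j = F 0 + F 1 + F 2.
Proof.
rewrite !big_ord_recl big_ord0 addr0 addrA.
by congr (F _ + F _ + F _); apply: val_inj.
Qed.

Lemma advectE (v w : 'rV[R]_3 -> 'rV[R]_3) (x : 'rV[R]_3) (k : 'I_3) : smooth w ->
  advect v w x 0 k = \sum_j v x 0 j * partial j (fun y => w y 0 k) x.
Proof.
move=> sw; rewrite /advect summxE; apply: eq_bigr => j _; rewrite mxE.
by congr (_ * _); exact: derive_entry (sw [::] x).
Qed.

Lemma laplacianE (w : 'rV[R]_3 -> 'rV[R]_3) (x : 'rV[R]_3) (k : 'I_3) : smooth w ->
  laplacian w x 0 k = \sum_j partial j (partial j (fun y => w y 0 k)) x.
Proof.
move=> sw; rewrite /laplacian summxE; apply: eq_bigr => j _.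
exact: (congr1 (fun f => f x) (esym (iter_partial_entry k [:: j; j] sw))).
Qed.

(** At angle 0 the vector [e_theta] is the second basis vector, so this is entry 1 of the induction
    equation. The terms divided by [r] or [r ^+ 2] come from the angular derivatives and the Hall
    term. *)
Lemma azimuthal_equation r z : 0 < r -> let x := row3 r 0 z in
  u x 0 0 * partial 0 h1 x + u x 0 2 * partial 2 h1 x - h1 x * u x 0 0 / r
    - 2 * h1 x * partial 2 h1 x / r
  = partial 0 (partial 0 h1) x + partial 0 h1 x / r - h1 x / r ^+ 2
    + partial 2 (partial 2 h1) x.
Proof.
move=> r0 x; have [_ _ eq3 _] := sol x.
have mxD3 (A B C : 'rV[R]_3) : (A - B + C) 0 1 = A 0 1 - B 0 1 + C 0 1.
  by rewrite !mxE.
have := congr1 (fun A : 'rV[R]_3 => A 0 1) eq3.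
rewrite mxD3 (advectE _ _ _ h_smooth) (advectE _ _ _ u_smooth) (laplacianE _ _ h_smooth).
rewrite hall_term // !sum_ord3.
have [_ -> _ ->] := angular_partials_h z r0; have [-> ->] := h_meridian z r0.
have [-> _] := angular_partials r0 (smooth_entry 1 u_smooth)
  (fun theta => u1_cyl theta z r0).
rewrite -/x; move: (partial 2 u1 _) (partial 0 u1 _) => a b.
move: (partial 2 (partial 2 h1) _) (partial 0 (partial 0 h1) _) => c d.
move: (partial 2 h1 _) (partial 0 h1 _) => e f H.
have r_neq0 : r != 0 by rewrite gt_eqF.
transitivity (u x 0 0 * f + u x 0 1 * 0 + u x 0 2 * e -
  (0 * b + h x 0 1 * (u x 0 0 / r) + 0 * a) - 2 * h x 0 1 * e / r); first by ring.
by rewrite H; field.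
Qed.

End Azimuthal.

(** * Reduction to the half-plane problem and return to the whole space *)

Section Conclusion.
Context {R : realType}.
Local Notation V := 'rV[R]_3.

Lemma quotient_jet (g : V -> R) r z : smooth g -> 0 < r ->
  jet2 (fun r z => g (row3 r 0 z) / r)
    (fun r z => partial 0 g (row3 r 0 z) / r - g (row3 r 0 z) / r ^+ 2)
    (fun r z => partial 0 (partial 0 g) (row3 r 0 z) / r
       - 2 * partial 0 g (row3 r 0 z) / r ^+ 2 + 2 * g (row3 r 0 z) / r ^+ 3)
    (fun r z => partial 2 g (row3 r 0 z) / r)
    (fun r z => partial 2 (partial 2 g) (row3 r 0 z) / r) r z.
Proof.
move=> sg r0; have {}r0 : r != 0 by rewrite gt_eqF.
have s0 := smooth_partial 0 sg; have s2 := smooth_partial 2 sg.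
have Did : is_derive r 1 id (1 : R) := is_derive_id r 1.
have DV := is_derive_inv Did r0.
have DV2 := is_derive_inv_sqr Did r0.
split.
- apply: (is_derive_eq (is_derive_mul (is_derive_meridian_r r z sg) DV)).
  by move: (partial 0 g _) (g _) => a b; field.
- apply: (is_derive_eq (is_derive_sub (is_derive_mul (is_derive_meridian_r r z s0) DV)
    (is_derive_mul (is_derive_meridian_r r z sg) DV2))).
  by move: (partial 0 g _) (partial 0 _ _) (g _) => a b c; field.
- apply: (is_derive_eq (is_derive_mul (is_derive_meridian_z r z sg) (is_derive_const r^-1 z))).
  by rewrite mulr0 addr0.
- apply: (is_derive_eq (is_derive_mul (is_derive_meridian_z r z s2) (is_derive_const r^-1 z))).
  by rewrite mulr0 addr0.
- have c1 : {for (r, z), continuous (fst : R * R -> R)} by exact: cvg_fst.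
  apply: continuousM; first exact: meridian_continuous.
  exact: continuousV.
Qed.

Lemma polar_angle (c s : R) : c ^+ 2 + s ^+ 2 = 1 -> exists t, cos t = c /\ sin t = s.
Proof.
move=> cs; have c1 : -1 <= c <= 1.
  by have s2 := sqr_ge0 s; apply/andP; split; nra.
have Ec : cos (acos c) = c by apply: acosK; rewrite in_itv.
have Es : sin (acos c) = `|s| by rewrite sin_acos // -cs addrAC subrr add0r sqrtr_sqr.
case: (leP 0 s) => s0.
  by exists (acos c); rewrite Ec Es ger0_norm.
by exists (- acos c); rewrite cosN sinN Ec Es ltr0_norm // opprK.
Qed.

Lemma cyl_point_surj (x : V) : 0 < x 0 0 ^+ 2 + x 0 1 ^+ 2 ->
  exists r t, 0 < r /\ x = cyl_point r t (x 0 2).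
Proof.
move=> s0; set s := _ + _ in s0; pose r := Num.sqrt s.
have r0 : 0 < r by rewrite sqrtr_gt0.
have rs : r ^+ 2 = s by rewrite sqr_sqrtr // ltW.
have [|t [ct st]] := @polar_angle (x 0 0 / r) (x 0 1 / r).
  by rewrite !expr_div_n -mulrDl rs divff // gt_eqF.
exists r, t; split=> //; rewrite {1}(row3_eta x) /cyl_point ct st.
by congr row3; rewrite mulrC divfK // gt_eqF.
Qed.

Lemma smooth_axis_eq0 (g : V -> R) z : smooth g ->
  (forall r, 0 < r -> g (row3 r 0 z) = 0) -> g (row3 0 0 z) = 0.
Proof.
move=> sg g0; apply/eqP; rewrite -normr_le0; apply/ler_addgt0Pl => e e0; rewrite addr0.
have := is_derive_continuous (is_derive_meridian_r 0 z sg).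
move=> /cvgrPdist_lt/(_ _ e0)[d /= d0 Hd].
have /Hd : ball_ Num.norm 0 d (d / 2) by rewrite /ball_ /= sub0r normrN gtr0_norm; lra.
by rewrite (g0 (d / 2)) ?divr_gt0 // subr0 => /ltW.
Qed.

Lemma entry_at_infinity (w : V -> V) (e : R) : w x @[x --> at_infinity] --> (0 : V) ->
  0 < e -> exists A, forall r z (k : 'I_3), 0 < r -> A < Num.max r `|z| ->
    `|w (row3 r 0 z) 0 k| <= e.
Proof.
have le_norm (x : V) (k : 'I_3) : `|x 0 k| <= `|x|.
  by rewrite [leRHS]/Num.Def.normr/= mx_normrE; exact: (le_bigmax _ _ (0, k)).
move=> /cvgrPdist_lt w0 /w0[A _ HA]; exists A => r z k r0 Ar.
have [E0 _ E2] := row3E r 0 z.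
have xA : A < `|row3 r 0 z|.
  apply: lt_le_trans Ar _; rewrite ge_max; apply/andP; split.
    by rewrite -{1}E0 (le_trans (ler_norm _)).
  by rewrite -{1}E2.
by have /ltW := HA _ xA; rewrite sub0r normrN; apply: le_trans.
Qed.

End Conclusion.

Theorem theorem4p2 (R : realType)
  (u h : 'rV[R]_3 -> 'rV[R]_3) (p : 'rV[R]_3 -> R)
  (u_smooth : smooth u) (h_smooth : smooth h) (p_smooth : smooth p)
  (sol : steady_hall_mhd u h p)
  (u_vanishes : u x @[x --> at_infinity] --> (0 : 'rV[R]_3))
  (h_vanishes : h x @[x --> at_infinity] --> (0 : 'rV[R]_3))
  (u_r u_theta u_z h_theta : R -> R -> R)
  (u_form : forall r theta z : R, 0 < r ->
     u (cyl_point r theta z) =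
       u_r r z *: e_r theta + u_theta r z *: e_theta theta + u_z r z *: e_z)
  (h_form : forall r theta z : R, 0 < r ->
     h (cyl_point r theta z) = h_theta r z *: e_theta theta) :
  forall x : 'rV[R]_3, h x = 0.
Proof.
pose h1 y := h y 0 1.
have s1 : smooth h1 by exact: smooth_entry.
pose ur r z := u (row3 r 0 z) 0 0.
pose uz r z := u (row3 r 0 z) 0 2.
(* The point with first coordinate [- r] has angle [pi], where [e_theta] is reversed. *)
have odd r z : 0 < r -> h1 (row3 (- r) 0 z) = - h1 (row3 r 0 z).
  move=> r0; have [_ + _] := h_cyl h_form pi z r0.
  by rewrite /cyl_point cospi sinpi mulrN1 mulr0 /h1 => ->; ring.
have bnd a : exists M, forall r z, 0 < r <= a -> `|z| <= a ->
    `|ur r z| <= M /\ `|h1 (row3 r 0 z) / r| <= M.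
  have [M HM] := meridian_bounded a (smooth_entry 0 u_smooth).
  have [N HN] := meridian_bounded a (smooth_partial 0 s1).
  exists (Num.max M N) => r z /andP[r0 ra] za; rewrite !le_max.
  split; first by rewrite HM // gtr0_norm.
  have rr : - r < r by lra.
  (* By oddness the increment of [h1] from [- r] to [r] is [2 * h1], so [h1 / r] equals a value of
     the bounded function [partial 0 h1]: the quotient stays bounded up to the axis. *)
  have [c [cr rc]] := mean_value rr (fun t => is_derive_meridian_r t z s1).
  rewrite odd // => E.
  have -> : h1 (row3 r 0 z) / r = partial 0 h1 (row3 c 0 z).
    have rn0 : r != 0 by rewrite gt_eqF.
    apply: (mulIf rn0); rewrite divfK //; move: E.
    by move: (partial 0 h1 _) (h1 _) => a' b'; lra.
  by rewrite HN ?orbT // ler_norml; lra.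
have decay e : 0 < e -> exists A, forall r z, 0 < r -> A < Num.max r `|z| ->
    [/\ `|ur r z| <= e, `|uz r z| <= e & r * `|h1 (row3 r 0 z) / r| <= e].
  move=> e0; have [A HA] := entry_at_infinity u_vanishes e0.
  have [B HB] := entry_at_infinity h_vanishes e0.
  exists (Num.max A B) => r z r0; rewrite gt_max => /andP[Ar Br].
  split; [exact: HA|exact: HA|].
  rewrite normrM normfV [`|r|]gtr0_norm // mulrC divfK ?gt_eqF //.
  exact: HB.
have P0 := half_plane_liouville (ur := ur) (uz := uz)
  (fun r z r0 => quotient_jet z s1 r0) _ bnd decay.
have {}P0 r z : 0 < r -> h1 (row3 r 0 z) = 0.
  move=> r0; have : h1 (row3 r 0 z) / r = 0.
    apply: P0 r0 => {}r {}z r0.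
    have := azimuthal_equation u_smooth h_smooth sol u_form h_form z r0.
    rewrite /= -/h1 -/(h1 _) -/(ur r z) -/(uz r z).
    move: (partial 2 (partial 2 h1) _) (partial 0 (partial 0 h1) _) => c d.
    move: (partial 2 h1 _) (partial 0 h1 _) (h1 _) => e f g E.
    have rn0 : r != 0 by rewrite gt_eqF.
    (* The equation for [h1 / r] is the azimuthal equation divided by [r]. *)
    transitivity ((d + f / r - g / r ^+ 2 + c
      - (ur r z * f + uz r z * e - g * ur r z / r - 2 * g * e / r)) / r).
      by field.
    by rewrite E subrr mul0r.
  by move/eqP; rewrite mulf_eq0 invr_eq0 [r == 0]gt_eqF // orbF => /eqP.
(* The cylindrical form of [h] says nothing on the axis itself, which is reached by continuity. *)
have axis0 z (k : 'I_3) : h (row3 0 0 z) 0 k = 0.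
  apply: (smooth_axis_eq0 (g := fun y => h y 0 k) (smooth_entry k h_smooth)) => r r0.
  have [e0 e2] := h_meridian h_form z r0.
  case: k => [] [|[|[|//]]] Hk.
  - by rewrite -[RHS]e0; congr (h _ _ _); apply: val_inj.
  - by rewrite -[RHS](P0 r z r0); congr (h _ _ _); apply: val_inj.
  - by rewrite -[RHS]e2; congr (h _ _ _); apply: val_inj.
move=> x; have [s0|] := ltP 0 (x 0 0 ^+ 2 + x 0 1 ^+ 2).
  have [r [t [r0 ->]]] := cyl_point_surj s0.
  have := P0 r (x 0 2) r0; rewrite /h1 -cyl_point0 !h_form // !mxE /= cos0 mulr1 => ->.
  by rewrite scale0r.
move=> s0; have q0 := sqr_ge0 (x 0 0); have q1 := sqr_ge0 (x 0 1).
have x0 : x 0 0 = 0 by apply/eqP; rewrite -sqrf_eq0 eq_le q0 andbT; lra.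
have x1 : x 0 1 = 0 by apply/eqP; rewrite -sqrf_eq0 eq_le q1 andbT; lra.
by apply/rowP => k; rewrite (row3_eta x) x0 x1 axis0 mxE.
Qed.
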